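(* Let $\{\xi_1,\xi_2,\dots\}$ be a sequence of independent real-valued random variables (not necessarily identically distributed), with distribution functions $F_{\xi_1},F_{\xi_2},\dots$ and tails $\overline{F}_{\xi_k}=1-F_{\xi_k}$, and let $\eta$ be a counting random variable independent of $\{\xi_1,\xi_2,\dots\}$. Let $\xi_{(\eta)}$ be the randomly stopped maximum, i.e. $\xi_{(\eta)}=\max\{0,\xi_1,\dots,\xi_\eta\}$ if $\eta\geqslant 1$ and $\xi_{(\eta)}=0$ if $\eta=0$. Suppose that the following conditions hold for some index $\varkappa\in\mathrm{supp}(\eta)$, $\varkappa\geqslant 1$, and some sequence $\{\varphi(n)\}_{n=1}^\infty$ of positive numbers: (a) $F_{\xi_\varkappa}\in\mathcal{C}$; (b) for each $k\neq\varkappa$, either $F_{\xi_k}\in\mathcal{C}$ or $\overline{F}_{\xi_k}(x)=o\bigl(\overline{F}_{\xi_\varkappa}(x)\bigr)$ as $x\to\infty$; (c) $$\limsup_{x\to\infty}\ \sup_{n\geqslant 1}\ \frac{1}{\varphi(n)\,\overline{F}_{\xi_\varkappa}(x)}\sum_{k=1}^{n}\overline{F}_{\xi_k}(x)<\infty,$$ where $\mathbb{E}\bigl(\varphi(\eta)\mathbf{1}_{[1,\infty)}(\eta)\bigr)<\infty$. Then the distribution function $F_{\xi_{(\eta)}}$ of $\xi_{(\eta)}$ belongs to the class $\mathcal{C}$.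
   Context: A counting random variable is an integer-valued, nonnegative random variable that is nondegenerate at zero (i.e. $\mathbb{P}(\eta=0)<1$). ''$\eta$ independent of $\{\xi_1,\xi_2,\dots\}$'' means that $\eta$ is independent of the whole sequence. Its support is $\mathrm{supp}(\eta):=\{n\in\mathbb{Z}_+:\mathbb{P}(\eta=n)>0\}$. For a distribution function $F$ write $\overline{F}(x)=1-F(x)$. The class $\mathcal{C}$ of consistently varying distributions consists of the distribution functions $F$ (on $\mathbb{R}$, with $\overline F(x)>0$ for all $x$, so that the ratios make sense) such that $$\lim_{y\uparrow 1}\ \limsup_{x\to\infty}\frac{\overline{F}(xy)}{\overline{F}(x)}=1.$$ The notation $f(x)=o(g(x))$ means $\lim_{x\to\infty}f(x)/g(x)=0$. $\mathbf{1}_A$ denotes the indicator function of the set $A$. *)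

(* Defs.v *)
From HB Require Import structures.
From mathcomp Require Import all_boot all_order all_algebra.
From mathcomp Require Import all_classical all_reals all_analysis.

Set Implicit Arguments.
Unset Strict Implicit.
Unset Printing Implicit Defensive.

Import Order.TTheory GRing.Theory Num.Theory.
Import numFieldNormedType.Exports.

Local Open Scope classical_set_scope.
Local Open Scope ring_scope.

Section distribution_function.
Context d (T : measurableType d) (R : realType) (P : probability T R).
Variable X : {RV P >-> R}.

(* Real-valued version of the library's cdf : F_X(x) = P(X <= x). *)
Definition distr_fun (x : R) : R := fine (cdf X x).

Let distr_fun_nd : nondecreasing distr_fun.
Proof.
by move=> x y xy; rewrite fine_le ?fin_num_measure// cdf_nondecreasing.
Qed.

Let distr_fun_rc : right_continuous distr_fun.
Proof.
move=> x; apply: fine_cvg.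
by rewrite fineK ?fin_num_measure//; exact: cdf_right_continuous.
Qed.

HB.instance Definition _ :=
  isCumulative.Build R _ R distr_fun distr_fun_nd distr_fun_rc.

Let distr_funNy0 : distr_fun @ -oo --> (0 : R).
Proof. exact/fine_cvg/cvg_cdfNy0. Qed.

Let distr_funy1 : distr_fun @ +oo --> (1 : R).
Proof. exact/fine_cvg/cvg_cdfy1. Qed.

HB.instance Definition _ :=
  isCumulativeBounded.Build R 0 1 distr_fun distr_funNy0 distr_funy1.

End distribution_function.
Arguments distr_fun {d T R} P X x.

Definition tail (R : realType) (F : R -> R) (x : R) : R := 1 - F x.

(* The class C. Distribution functions on the real line are exactly the
   nondecreasing right-continuous functions with limits 0 at -oo and 1 at +oo,
   i.e. the inhabitants of [cumulativeBounded 0 1]. *)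
Definition consistently_varying (R : realType)
    (F : cumulativeBounded (0 : R) (1 : R)) : Prop :=
  (forall x, 0 < tail F x) /\
  limf_esup (fun x : R => (tail F (x * y) / tail F x)%:E) +oo
    @[y --> (1 : R)^'-] --> 1%E.

Section independence.
Context d (T : measurableType d) (R : realType) (P : probability T R).
Local Open Scope ereal_scope.

Definition mutually_independent (I : set nat) (X : nat -> {RV P >-> R}) : Prop :=
  forall (J : seq nat) (B : nat -> set R),
    uniq J -> [set` J] `<=` I -> (forall k, measurable (B k)) ->
    P (\bigcap_(k in [set` J]) (X k @^-1` B k)) =
    \prod_(k <- J) P (X k @^-1` B k).

(* sigma(X_k : k in I) *)
Definition sigma_of_family (I : set nat) (X : nat -> {RV P >-> R}) :
    set (set T) :=
  <<s \bigcup_(k in I) g_sigma_algebra_preimage (X k) >>.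

Definition independent_of_family (I : set nat) (X : nat -> {RV P >-> R})
    (Y : {RV P >-> nat}) : Prop :=
  forall A B : set T,
    g_sigma_algebra_preimage Y A -> sigma_of_family I X B ->
    P (A `&` B) = P A * P B.

Definition supp (Y : {RV P >-> nat}) : set nat :=
  [set n | 0 < P (Y @^-1` [set n])].

(* Counting random variables are nat-valued, so that only nondegeneracy at
   zero has to be required. *)
Definition nondegenerate_at_zero (Y : {RV P >-> nat}) : Prop :=
  P (Y @^-1` [set 0%N]) < 1.

End independence.
Arguments mutually_independent {d T R} P I X.
Arguments sigma_of_family {d T R P} I X.
Arguments independent_of_family {d T R} P I X Y.
Arguments supp {d T R} P Y.
Arguments nondegenerate_at_zero {d T R} P Y.

Section stopped_maximum.
Context d (T : measurableType d) (R : realType) (P : probability T R).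
Variables (X : nat -> {RV P >-> R}) (Y : {RV P >-> nat}).

(* max{0, X_1, ..., X_Y}; the value is 0 when Y = 0, and X_0 is not used. *)
Definition stopped_max (w : T) : R :=
  \big[Num.max/0]_(1 <= k < (Y w).+1) X k w.

Let measurable_stopped_max : measurable_fun setT stopped_max.
Proof.
have mM (r : seq nat) :
    measurable_fun setT (fun w => \big[Num.max/0]_(k <- r) X k w).
  elim: r => [|k r IHr].
    by under eq_fun do rewrite big_nil; exact: measurable_cst.
  under eq_fun do rewrite big_cons.
  by apply: measurable_realfun.measurable_maxr => //; exact: measurable_funPT.
have -> : [set: T] = \bigcup_n (Y @^-1` [set n]).
  by apply/seteqP; split => // w _; exists (Y w).
have mY n : measurable (Y @^-1` [set n]).
  by rewrite -[X in measurable X]setTI; exact: measurable_funPT.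
apply/measurable_fun_bigcup => // n.
apply: (eq_measurable_fun
  (fun w => \big[Num.max/0]_(1 <= k < n.+1) X k w)).
  by move=> w /set_mem /= <-.
exact: measurable_funTS.
Qed.

HB.instance Definition _ :=
  isMeasurableFun.Build _ _ _ _ stopped_max measurable_stopped_max.

End stopped_maximum.

(* Main.v *)
Require Import Defs.
From HB Require Import structures.
From mathcomp Require Import all_boot all_order all_algebra.
From mathcomp Require Import all_classical all_reals all_analysis.
From mathcomp Require Import ring lra.

Set Implicit Arguments.
Unset Strict Implicit.
Unset Printing Implicit Defensive.

Import Order.TTheory GRing.Theory Num.Theory.
Import numFieldNormedType.Exports.

Local Open Scope classical_set_scope.
Local Open Scope ring_scope.

(** Write t_k for the tail of xi_k, M for the stopped maximum and G for its
    tail. For 0 <= z <= x, if z < M <= x then either z < xi_k <= x for some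
    k <= N, or eta > N and M > z, so that
      G(z) - G(x) <= sum_(k <= N) (t_k(z) - t_k(x)) + P(eta > N, M > z).
    Take z = xy. By (a), (b) and (c) each increment t_k(xy) - t_k(x) is at most
    e t_kappa(x) for y close to 1 and x large. By independence of eta and (c),
    the last term is at most C t_kappa(xy) E[phi(eta); eta > N], where the
    expectation is small for N large and t_kappa(xy) <= 2 t_kappa(x). Finally
    t_kappa(x) <= G(x) / P(eta = kappa), so G(xy) - G(x) is small compared with
    G(x). *)

(** * Increments relative to a gauge function, and the class C *)

Section small_increments.
Context {R : realType}.
Implicit Types (f g : R -> R) (y : R).

(** A division-free form of consistent variation, with a gauge [g] allowed to differ from [f]. The
    separate gauge is what lets increments of different tails be added. *)
Definition small_increments f g : Prop :=
  forall e, 0 < e ->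
    \forall y \near (1 : R)^'-, \forall x \near +oo, f (x * y) - f x <= e * g x.

Lemma small_increments0 g :
  (forall x, 0 <= g x) -> small_increments (fun=> 0) g.
Proof.
move=> g0 e e0; near=> y; near=> x.
by rewrite subrr mulr_ge0// ltW.
Unshelve. all: by end_near. Qed.

Lemma small_incrementsD f1 f2 g : small_increments f1 g ->
  small_increments f2 g -> small_increments (f1 \+ f2) g.
Proof.
move=> h1 h2 e e0; have e20 : 0 < e / 2 by rewrite divr_gt0.
have {}h1 := h1 _ e20; have {}h2 := h2 _ e20.
near=> y.
have h1y : \forall x \near +oo, f1 (x * y) - f1 x <= e / 2 * g x by near: y.
have h2y : \forall x \near +oo, f2 (x * y) - f2 x <= e / 2 * g x by near: y.
near=> x.
have a1 : f1 (x * y) - f1 x <= e / 2 * g x by near: x.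
have a2 : f2 (x * y) - f2 x <= e / 2 * g x by near: x.
rewrite /=; lra.
Unshelve. all: by end_near. Qed.

Lemma small_increments_sum (f : nat -> R -> R) g n :
  (forall x, 0 <= g x) -> (forall k, small_increments (f k) g) ->
  small_increments (fun x => \sum_(k < n) f k x) g.
Proof.
move=> g0 fg; elim: n => [|n IHn].
  rewrite [X in small_increments X _](_ : _ = fun=> 0).
    exact: small_increments0.
  by apply/funext => x; rewrite big_ord0.
rewrite [X in small_increments X _](_ : _ =
    (fun x => \sum_(k < n) f k x) \+ f n).
  exact: small_incrementsD.
by apply/funext => x; rewrite big_ord_recr.
Qed.

(** The constant is absorbed by using [e / B]. This changes the gauge twice: from the own tail of a
    variable to that of index [kappa], and from the latter to the tail of the stopped maximum. *)
Lemma small_increments_dom f g1 g2 B : 0 < B ->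
  (\forall x \near +oo, g1 x <= B * g2 x) ->
  small_increments f g1 -> small_increments f g2.
Proof.
move=> B0 dom fg e e0; have := fg (e / B) (divr_gt0 e0 B0).
move=> {}fg; near=> y.
have fgy : \forall x \near +oo, f (x * y) - f x <= e / B * g1 x by near: y.
near=> x.
have a1 : f (x * y) - f x <= e / B * g1 x by near: x.
have a2 : g1 x <= B * g2 x by near: x.
rewrite (le_trans a1)// -mulrA ler_wpM2l ?(ltW e0)//.
by rewrite ler_pdivrMl.
Unshelve. all: by end_near. Qed.

Lemma near_scale_pinfty (P : R -> Prop) y : 0 < y ->
  (\forall x \near +oo, P x) -> \forall x \near +oo, P (x * y).
Proof.
move=> y0 [M [Mr MP]]; near=> x; apply: MP.
rewrite -ltr_pdivrMr//; near: x; apply: nbhs_pinfty_gt.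
exact: num_real.
Unshelve. all: by end_near. Qed.

Lemma near_le_double g : (forall x, 0 < g x) -> small_increments g g ->
  \forall y \near (1 : R)^'-, \forall x \near +oo, g (x * y) <= 2 * g x.
Proof.
move=> g0 /(_ _ ltr01) gg; near=> y.
have ggy : \forall x \near +oo, g (x * y) - g x <= 1 * g x by near: y.
by apply: filterS ggy => x; lra.
Unshelve. all: by end_near. Qed.

Lemma small_increments_littleo f g :
  (forall x, 0 <= f x) -> (forall x, 0 < g x) ->
  small_increments g g -> f x / g x @[x --> +oo] --> 0 ->
  small_increments f g.
Proof.
move=> f0 g0 gg fg0 e e0.
have fge : \forall x \near +oo, f x <= e / 2 * g x.
  move/cvgrPdist_le: fg0 => /(_ (e / 2)); rewrite divr_gt0// => /(_ isT).
  apply: filterS => x; rewrite sub0r normrN ger0_norm ?divr_ge0 ?(ltW (g0 x))//.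
  by rewrite ler_pdivrMr.
have gg2 := near_le_double g0 gg.
near=> y.
have y0 : 0 < y by near: y; exact: nbhs_left_gt.
have gg2y : \forall x \near +oo, g (x * y) <= 2 * g x by near: y.
have fgy := near_scale_pinfty y0 fge.
near=> x.
have a1 : f (x * y) <= e / 2 * g (x * y) by near: x.
have a2 : g (x * y) <= 2 * g x by near: x.
have : e / 2 * g (x * y) <= e / 2 * (2 * g x).
  by rewrite ler_wpM2l// divr_ge0// ltW.
have := f0 x; nra.
Unshelve. all: by end_near. Qed.

(** The set where [h] is at most [l] is itself one of the neighbourhoods over which the infimum is
    taken. *)
Lemma limf_esup_le (h : R -> \bar R) (l : \bar R) :
  (\forall x \near +oo, (h x <= l)%E) -> (limf_esup h +oo%R <= l)%E.
Proof.
move=> hl; rewrite /limf_esup.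
apply: (@le_trans _ _ (ereal_sup [set h x | x in [set x | (h x <= l)%E]])).
  by apply: ereal_inf_lbound; exists [set x | (h x <= l)%E].
by apply: ge_ereal_sup => _ [x hx <-].
Qed.

Lemma near_limf_esup_lt (h : R -> \bar R) (l : \bar R) :
  (limf_esup h +oo%R < l)%E -> \forall x \near +oo, (h x < l)%E.
Proof.
move=> /ereal_inf_lt[_ [V Vy <-] Vl].
apply: filterS Vy => x Vx; apply: le_lt_trans Vl.
by apply: ereal_sup_ubound; exists x.
Qed.

Lemma limf_esup_ge (h : R -> \bar R) (l : \bar R) :
  (\forall x \near +oo, (l <= h x)%E) -> (l <= limf_esup h +oo%R)%E.
Proof.
move=> hl; apply: le_ereal_inf_tmp => _ [V Vy <-].
have [x [lx Vx]] := filter_ex (filterI hl Vy).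
by apply: le_trans lx _; apply: ereal_sup_ubound; exists x.
Qed.

(** For y < 1 and x > 0 monotonicity makes the ratio at least 1, hence also its limsup. Convergence
    to 1 therefore amounts to upper bounds 1 + e, which are bounds on increments. *)
Lemma consistently_varyingP (F : cumulativeBounded (0 : R) (1 : R)) :
  consistently_varying F <->
  (forall x, 0 < tail F x) /\ small_increments (tail F) (tail F).
Proof.
have tail_ni : {homo tail F : a b / a <= b >-> b <= a}.
  by move=> a b ab; rewrite /tail lerB// cumulative_is_nondecreasing.
split=> -[F0 h]; split => //.
  move=> e e0.
  have h1 : \forall y \near (1 : R)^'-,
      (limf_esup (fun x : R => (tail F (x * y) / tail F x)%:E) +oo%R < (1 + e)%:E)%E.
    apply: (h [set z | (z < (1 + e)%:E)%E]).
    by apply: open_ereal_lt'; rewrite lte_fin; lra.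
  apply: filterS h1 => y /near_limf_esup_lt.
  apply: filterS => x; rewrite lte_fin ltr_pdivrMr// => ?; lra.
have lb : \forall y \near (1 : R)^'-,
    (1%:E <= limf_esup (fun x : R => (tail F (x * y) / tail F x)%:E) +oo%R)%E.
  near=> y; apply: limf_esup_ge; near=> x.
  rewrite lee_fin ler_pdivlMr// mul1r; apply: tail_ni.
  by rewrite ler_piMr.
apply/fine_cvgP.
have ub e : 0 < e -> \forall y \near (1 : R)^'-,
    (limf_esup (fun x : R => (tail F (x * y) / tail F x)%:E) +oo%R <= (1 + e)%:E)%E.
  move=> /h; apply: filterS => y hy; apply: limf_esup_le.
  apply: filterS hy => x hx; rewrite lee_fin ler_pdivrMr//; lra.
split.
  (* The limsup is an extended real; the bounds 1 and 1 + 1 show that it is finite for y close to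
     1. *)
  have := ub _ ltr01; apply: filterS2 lb => y lby uby.
  rewrite fin_numElt (lt_le_trans _ lby) ?ltNyr//=.
  by rewrite (le_lt_trans uby) ?ltry.
apply/cvgrPdist_le => e /ub; apply: filterS2 lb => y.
rewrite /=; case: limf_esup => // r; rewrite !lee_fin/= => ? ?.
by rewrite distrC ger0_norm; lra.
Unshelve. all: by end_near. Qed.

End small_increments.

(** * Tails as probabilities of events *)

Section tail_of_random_variable.
Context d (T : measurableType d) (R : realType) (P : probability T R).
Implicit Types X : {RV P >-> R}.

Lemma measurable_gt_RV X x : measurable [set w | x < X w].
Proof.
rewrite -[X in measurable X]setTI.
have -> : [set w | x < X w] = X @^-1` `]x, +oo[%classic.
  by apply/seteqP; split=> w /=; rewrite in_itv/= andbT.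
exact: measurable_funPT.
Qed.

Lemma measurable_eq_RV (Y : {RV P >-> nat}) n : measurable [set w | Y w = n].
Proof.
rewrite -[X in measurable X]setTI.
have -> : [set w | Y w = n] = Y @^-1` [set n] by [].
exact: measurable_funPT.
Qed.

Lemma tail_distr_fun X x :
  (tail (distr_fun P X) x)%:E = P [set w | x < X w].
Proof.
rewrite /tail /distr_fun EFinB fineK ?fin_num_measure//.
rewrite -ccdf_1_cdf /ccdf /distribution /pushforward; congr (P _).
by apply/seteqP; split=> w /=; rewrite in_itv/= andbT.
Qed.

Lemma tail_distr_fun_ge0 X x : 0 <= tail (distr_fun P X) x.
Proof. by rewrite -lee_fin tail_distr_fun. Qed.

Lemma between_setD X z x :
  [set w | z < X w <= x] = [set w | z < X w] `\` [set w | x < X w].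
Proof.
apply/seteqP; split=> w /=.
  by move=> /andP[-> ?]; split=> //; apply/negP; rewrite -leNgt.
by move=> [-> /negP]; rewrite -leNgt.
Qed.

Lemma measurable_between X z x : measurable [set w | z < X w <= x].
Proof. by rewrite between_setD; apply: measurableD; exact: measurable_gt_RV. Qed.

Lemma prob_between X z x : z <= x ->
  P [set w | z < X w <= x] =
  (tail (distr_fun P X) z - tail (distr_fun P X) x)%:E.
Proof.
move=> zx; rewrite EFinB !tail_distr_fun.
rewrite between_setD measureD ?ltey_eq ?fin_num_measure//; try exact: measurable_gt_RV.
congr (_ - P _)%E; apply/seteqP; split=> w /=; first by case.
by move=> xw; split=> //; exact: le_lt_trans xw.
Qed.

Lemma independent_gt (I : set nat) (xi : nat -> {RV P >-> R})
    (eta : {RV P >-> nat}) k n (z : R) :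
  independent_of_family P I xi eta -> I k ->
  P ([set w | eta w = n] `&` [set w | (z < xi k w)%R]) =
  (P [set w | eta w = n] * (tail (distr_fun P (xi k)) z)%:E)%E.
Proof.
move=> ind Ik; rewrite tail_distr_fun; apply: ind.
  by exists [set n]; rewrite // setTI.
apply: sub_gen_smallest; exists k => //.
exists `]z, +oo[%classic; first exact: measurable_itv.
by rewrite setTI; apply/seteqP; split=> w /=; rewrite in_itv/= andbT.
Qed.

End tail_of_random_variable.

(** * Bounds on the tail of the stopped maximum *)

Section stopped_maximum.
Context d (T : measurableType d) (R : realType) (P : probability T R).
Variables (xi : nat -> {RV P >-> R}) (eta : {RV P >-> nat}).
Local Notation t k := (tail (distr_fun P (xi k))).
Local Notation M := (stopped_max xi eta).
Local Notation G := (tail (distr_fun P (stopped_max xi eta))).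

(** As z >= 0, the entry 0 of the maximum cannot exceed z. Indices are shifted by one so that sums
    and unions can run over ordinals. *)
Lemma stopped_max_gtP z w : 0 <= z ->
  z < M w <-> exists2 k, (k < eta w)%N & z < xi k.+1 w.
Proof.
move=> z0; rewrite /stopped_max big_add1/= big_mkord; split.
  move=> /bigmax_gtP[|[i _ zi]]; first by rewrite ltNge z0.
  by exists i.
by move=> [k kn zk]; apply/bigmax_gtP; right; exists (Ordinal kn).
Qed.

Lemma le_stopped_max k w : (0 < k <= eta w)%N -> xi k w <= M w.
Proof.
case: k => // k kn; rewrite /stopped_max big_add1/= big_mkord.
exact: (le_bigmax_cond _ _ (j := Ordinal kn)).
Qed.

Lemma measurable_stopped_max_gt z : measurable [set w | z < M w].
Proof. exact: (@measurable_gt_RV _ _ _ P M). Qed.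

Lemma measurable_ge_eta N : measurable [set w | (N <= eta w)%N].
Proof.
rewrite -[X in measurable X]setTI.
have -> : [set w | (N <= eta w)%N] = eta @^-1` [set n | (N <= n)%N] by [].
exact: measurable_funPT.
Qed.

Lemma stopped_max_increment N (z x : R) : 0 <= z -> z <= x ->
  ((G z)%:E <= (G x)%:E + (\sum_(k < N) (t k.+1 z - t k.+1 x))%:E
     + P ([set w | (N <= eta w)%N] `&` [set w | (z < M w)%R]))%E.
Proof.
move=> z0 zx.
pose B k := [set w | z < xi k.+1 w <= x].
have mB k : measurable (B k) by exact: measurable_between.
have mU : measurable (\big[setU/set0]_(k < N) B k).
  exact: bigsetU_measurable.
have mE := measurableI _ _ (measurable_ge_eta N) (measurable_stopped_max_gt z).
have mG := measurable_stopped_max_gt.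
apply: (@le_trans _ _ (P ([set w | x < M w] `|` \big[setU/set0]_(k < N) B k
    `|` ([set w | (N <= eta w)%N] `&` [set w | (z < M w)%R])))).
  rewrite tail_distr_fun; apply: le_measure; rewrite ?inE//.
    by apply: measurableU => //; exact: measurableU.
  (* If eta < N and M <= x, a variable of index at most eta that exceeds z is also at most M <= x,
     so [w] lies in some [B k]. *)
  move=> w /= zM; have [Nw|wN] := leqP N (eta w); first by right.
  left; have [xM|Mx] := ltP x (M w); first by left.
  right; have [k kw zk] := (stopped_max_gtP w z0).1 zM.
  rewrite -bigcup_mkord; exists k => /=; first exact: ltn_trans wN.
  by rewrite /B /= zk/= (le_trans _ Mx)// le_stopped_max.
apply: (le_trans (measureU2 _ (measurableU _ _ (mG _) mU) mE)).
rewrite leeD2r// tail_distr_fun.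
apply: (le_trans (measureU2 _ (mG _) mU)).
rewrite leeD2l//; apply: (le_trans (Boole_inequality _ _)) => //.
by rewrite -sumEFin; apply: lee_sum => k _; rewrite -prob_between.
Qed.

Hypothesis indep : independent_of_family P [set k | (1 <= k)%N] xi eta.

(** On the event eta = k the maximum dominates [xi k], and independence factors the probability. *)
Lemma stopped_max_tail_ge k x : (1 <= k)%N ->
  (P (eta @^-1` [set k]) * (t k x)%:E <= (G x)%:E)%E.
Proof.
move=> k1; rewrite -(independent_gt _ _ indep)// [leRHS]tail_distr_fun.
apply: le_measure; rewrite ?inE//.
- by apply: measurableI; [exact: measurable_eq_RV|exact: measurable_gt_RV].
- exact: measurable_stopped_max_gt.
- by move=> w /= [kw xk]; rewrite (lt_le_trans xk)// le_stopped_max// kw k1/=.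
Qed.

(** The event is split by the value n of eta. For each n a union bound over the first n variables
    and independence give P(eta = n) times a sum of tails, which is at most C psi(n) P(eta = n). *)
Lemma stopped_max_gt_large_index N (z C : R) (psi : nat -> R) :
  0 <= z -> 0 <= C -> (forall n, 0 <= psi n) ->
  (forall n, \sum_(k < n) t k.+1 z <= C * psi n) ->
  (P ([set w | (N <= eta w)%N] `&` [set w | (z < M w)%R]) <=
   C%:E * \sum_(N <= n <oo) ((psi n)%:E * P (eta @^-1` [set n])))%E.
Proof.
move=> z0 C0 psi0 tC.
pose F n := [set w | eta w = n] `&` [set w | z < M w].
have mF n : measurable (F n).
  apply: measurableI; first exact: measurable_eq_RV.
  exact: measurable_stopped_max_gt.
apply: (le_trans (measure_sigma_subadditive_tail P (N := N) mF _ _)).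
- apply: measurableI; first exact: measurable_ge_eta.
  exact: measurable_stopped_max_gt.
- move=> w /= [Nw zM]; exists (eta w) => //=.
  by rewrite ltnNge Nw.
rewrite -nneseriesZl; last by move=> n _; rewrite mule_ge0// lee_fin.
apply: lee_nneseries => // n _.
rewrite muleA -EFinM.
pose H k := [set w | eta w = n] `&` [set w | z < xi k.+1 w].
have mH k : measurable (H k).
  by apply: measurableI; [exact: measurable_eq_RV|exact: measurable_gt_RV].
apply: (@le_trans _ _ (P (\big[setU/set0]_(k < n) H k))).
  apply: le_measure; rewrite ?inE//; first exact: bigsetU_measurable.
  move=> w [/= wn /(stopped_max_gtP _ z0)[k kn zk]].
  by rewrite -bigcup_mkord; exists k => //=; rewrite -wn.
apply: (le_trans (Boole_inequality _ _)) => //.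
rewrite (eq_bigr (fun k : 'I_n =>
    P [set w | eta w = n] * (t k.+1 z)%:E)%E); last first.
  by move=> k _; exact: (independent_gt _ _ indep).
rewrite -ge0_sume_distrr; last first.
  by move=> k _; rewrite lee_fin tail_distr_fun_ge0.
rewrite muleC sumEFin; apply: lee_wpmul2r; first exact: measure_ge0.
by rewrite lee_fin; exact: tC.
Qed.

End stopped_maximum.

(** The integral is cut along the level sets of [Y]. In this form the moment condition on [phi]
    yields a series with vanishing tails. *)
Lemma expectation_nat_RV d (T : measurableType d) (R : realType)
    (P : probability T R) (Y : {RV P >-> nat}) (psi : nat -> R) :
  (forall n, 0 <= psi n) ->
  ('E_P[fun w => psi (Y w)] =
   \sum_(0 <= n <oo) ((psi n)%:E * P (Y @^-1` [set n])))%E.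
Proof.
move=> psi0; rewrite unlock.
have U : [set: T] = \bigcup_n (Y @^-1` [set n]).
  by apply/seteqP; split => // w _; exists (Y w).
rewrite U ge0_integral_bigcup//.
- apply: eq_eseriesr => n _.
  rewrite -integral_cst//; last exact: measurable_eq_RV.
  by apply: eq_integral => w /set_mem /= ->.
- by move=> n; exact: measurable_eq_RV.
- rewrite -U; apply/measurable_realfun.measurable_EFinP.
  by apply: (measurableT_comp (f := psi)).
- by move=> w _; rewrite lee_fin.
- by apply/trivIsetP => i j _ _ ij; apply/seteqP; split=> // w /= [-> /eqP];
    rewrite (negbTE ij).
Qed.

(** * Choice of the constants and the final estimate *)

Theorem theorem4 (R : realType) (d : measure_display) (T : measurableType d)
  (P : probability T R) (xi : nat -> {RV P >-> R}) (eta : {RV P >-> nat})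
  (xi_indep : mutually_independent P [set k | (1 <= k)%N] xi)
  (eta_nondeg : nondegenerate_at_zero P eta)
  (eta_indep : independent_of_family P [set k | (1 <= k)%N] xi eta)
  (kappa : nat) (kappa_supp : supp P eta kappa) (kappa_ge1 : (1 <= kappa)%N)
  (phi : nat -> R) (phi_gt0 : forall n, (1 <= n)%N -> 0 < phi n)
  (Ha : consistently_varying (distr_fun P (xi kappa)))
  (Hb : forall k, (1 <= k)%N -> k <> kappa ->
     consistently_varying (distr_fun P (xi k)) \/
     tail (distr_fun P (xi k)) x / tail (distr_fun P (xi kappa)) x
       @[x --> +oo] --> (0 : R))
  (Hc : (limf_esup (fun x : R =>
           ereal_sup
             [set ((phi n * tail (distr_fun P (xi kappa)) x)^-1 *
                   \sum_(1 <= k < n.+1) tail (distr_fun P (xi k)) x)%:E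
             | n in [set n | (1 <= n)%N]]) +oo%R < +oo)%E)
  (Hphi : ('E_P[fun w => (phi (eta w) * \1_[set n | (1 <= n)%N] (eta w))%R]
           < +oo)%E) :
  consistently_varying (distr_fun P (stopped_max xi eta)).
Proof.
(* The indicator sets the value at 0 to 0, where the sign of [phi] is unknown; so [psi] is
   nonnegative everywhere. *)
pose psi n : R := phi n * \1_[set n | (1 <= n)%N] n.
have psi0E : psi 0%N = 0 by rewrite /psi indicE memNset ?mulr0//.
have psiSE n : psi n.+1 = phi n.+1 by rewrite /psi indicE mem_set ?mulr1.
have psi_ge0 n : 0 <= psi n.
  by case: n => [|n]; rewrite ?psi0E// psiSE ltW// phi_gt0.
set t := fun k => tail (distr_fun P (xi k)).
have [tk0 tk_inc] : (forall x, 0 < t kappa x) /\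
    small_increments (t kappa) (t kappa) by exact/consistently_varyingP.
have t_ge0 k x : 0 <= t k x by exact: tail_distr_fun_ge0.
have [C C0 HC] : exists2 C : R, 0 < C & (limf_esup (fun x : R =>
    ereal_sup [set ((phi n * t kappa x)^-1 *
      \sum_(1 <= k < n.+1) t k x)%:E
    | n in [set n | (1 <= n)%N]]) +oo%R < C%:E)%E.
  move: Hc; case: limf_esup => [r _||_].
  (* The absolute value and the added 1 give a positive constant strictly above the limsup. *)
  - exists (`|r| + 1); first by rewrite ltr_wpDl.
    by rewrite lte_fin ltr_pwDr// ler_norm.
  - by rewrite ltxx.
  - by exists 1; rewrite ?ltNyr.
have dom : \forall x \near +oo, forall n,
    \sum_(k < n) t k.+1 x <= C * t kappa x * psi n.
  move/near_limf_esup_lt : HC; apply: filterS => x xC [|n].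
    by rewrite big_ord0 psi0E mulr0.
  have : (((phi n.+1 * t kappa x)^-1 * \sum_(1 <= k < n.+2) t k x)%:E
      < C%:E)%E.
    by apply: le_lt_trans xC; apply: ereal_sup_ubound; exists n.+1.
  rewrite lte_fin mulrC ltr_pdivrMr ?mulr_gt0 ?phi_gt0//.
  rewrite big_add1 big_mkord psiSE => /ltW /le_trans; apply.
  by rewrite -mulrA [t kappa x * _]mulrC.
have inc k : small_increments (t k.+1) (t kappa).
  have [->//|/eqP kkappa] := eqVneq k.+1 kappa.
  case: (Hb k.+1 isT kkappa) => [/consistently_varyingP[tkS0 tkSi]|tko].
    (* The tail of index k + 1 is one term of the sum in [dom] for n = k + 1, so it is at most C
       psi(k + 1) times that of index [kappa]. *)
    have B0 : 0 < C * psi k.+1 by rewrite psiSE mulr_gt0// phi_gt0.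
    apply: (small_increments_dom B0 _ tkSi); apply: filterS dom => x /(_ k.+1).
    rewrite mulrAC big_ord_recr/=; apply: le_trans.
    by rewrite lerDr sumr_ge0.
  exact: small_increments_littleo.
set a := fine (P (eta @^-1` [set kappa])).
have aE : P (eta @^-1` [set kappa]) = a%:E.
  by rewrite fineK// fin_num_measure//; exact: measurable_eq_RV.
have a0 : 0 < a by rewrite -lte_fin -aE.
set G := tail (distr_fun P (stopped_max xi eta)).
have tG x : t kappa x <= a^-1 * G x.
  rewrite ler_pdivlMl// -lee_fin EFinM -aE.
  exact: stopped_max_tail_ge.
apply/consistently_varyingP; split=> [x|].
  have := lt_le_trans (tk0 x) (tG x).
  by rewrite pmulr_rgt0// invr_gt0.
(* By [tG] it suffices to compare the increments of [G] with [t kappa]. *)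
apply: (@small_increments_dom _ _ (t kappa) _ a^-1); rewrite ?invr_gt0//.
  exact: nearW.
move=> e e0.
(* [N] is fixed before y, since only finitely many increments are made small together. With e / (4C)
   the large-index term is at most (e/4) t(xy) <= (e/2) t(x), where t is the tail of index [kappa];
   the increments take the other e/2. *)
have [N HN] : exists N, (\sum_(N <= n <oo) ((psi n)%:E * P (eta @^-1` [set n]))
    < (e / (4 * C))%:E)%E.
  have psiP n : true -> (0 <= (psi n)%:E * P (eta @^-1` [set n]))%E.
    by move=> _; rewrite mule_ge0// lee_fin.
  move: Hphi; rewrite (@expectation_nat_RV _ _ _ _ eta psi)// => fin.
  have cvg0 := nneseries_tail_cvg fin psiP.
  have : \forall N \near \oo,
      (\sum_(N <= n <oo) ((psi n)%:E * P (eta @^-1` [set n]))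
       < (e / (4 * C))%:E)%E.
    apply: (cvg0 [set z | (z < (e / (4 * C))%:E)%E]).
    by apply: open_ereal_lt'; rewrite lte_fin divr_gt0// mulr_gt0.
  by move=> /filter_ex.
have e20 : 0 < e / 2 by rewrite divr_gt0.
have incN := small_increments_sum N (t_ge0 kappa) inc e20.
have dbl := near_le_double tk0 tk_inc.
near=> y.
have y0 : 0 < y by near: y; exact: nbhs_left_gt.
have y1 : y < 1 by near: y; exact: nbhs_left_lt.
have incNy : \forall x \near +oo, \sum_(k < N) t k.+1 (x * y) -
    \sum_(k < N) t k.+1 x <= e / 2 * t kappa x by near: y.
have dbly : \forall x \near +oo, t kappa (x * y) <= 2 * t kappa x by near: y.
have domy := near_scale_pinfty y0 dom.
near=> x.
have x0 : 0 < x by near: x; exact: nbhs_pinfty_gt.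
have h1 : \sum_(k < N) t k.+1 (x * y) -
    \sum_(k < N) t k.+1 x <= e / 2 * t kappa x by near: x.
have h2 : t kappa (x * y) <= 2 * t kappa x by near: x.
have h3 : forall n, \sum_(k < n) t k.+1 (x * y) <=
    C * t kappa (x * y) * psi n by near: x.
have xy0 : 0 <= x * y by rewrite mulr_ge0// ltW.
have xyx : x * y <= x by rewrite ler_piMr ?ltW.
have CT0 : 0 <= C * t kappa (x * y) by rewrite mulr_ge0// ltW.
(* The constant of the bound is here [C * t kappa (x * y)], from the domination at the point xy. *)
have := stopped_max_gt_large_index eta_indep N xy0 CT0 psi_ge0 h3.
have := stopped_max_increment xi eta N xy0 xyx.
rewrite sumrB => H1 H2.
have : ((G (x * y))%:E <= (G x + e / 2 * t kappa x +
    C * t kappa (x * y) * (e / (4 * C)))%:E)%E.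
  apply: (le_trans H1); rewrite !EFinD.
  apply: leeD; first by apply: leeD => //; rewrite lee_fin.
  apply: (le_trans H2); rewrite [leRHS]EFinM.
  by apply: lee_wpmul2l; [rewrite lee_fin|exact: ltW].
rewrite lee_fin => H3.
have H4 : C * t kappa (x * y) * (e / (4 * C)) = e / 4 * t kappa (x * y).
  by field; rewrite gt_eqF.
have : e / 4 * t kappa (x * y) <= e / 4 * (2 * t kappa x).
  by rewrite ler_wpM2l// divr_ge0// ltW.
rewrite -/G; move: H3; rewrite H4; lra.
Unshelve. all: by end_near. Qed.
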